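(* The set $\mathbb{R}$ of minimal rational Cauchy filters, with its ordering $<$, is complete: every non-empty set $\mathcal{A}\subseteq\mathbb{R}$ that is bounded above by some element of $\mathbb{R}$ has a least upper bound in $\mathbb{R}$.
   Context: For $q\in\mathbb{Q}$ and rational $\varepsilon>0$ let $q_\varepsilon=\{x\in\mathbb{Q}\mid q-\varepsilon<x<q+\varepsilon\}$. A (rational) filter is a non-empty collection $\mathcal{F}$ of subsets of $\mathbb{Q}$ closed under binary intersections and under supersets (in $\mathbb{Q}$); the improper filter $\mathcal{P}(\mathbb{Q})$ is allowed as a filter. A filter $\mathcal{F}$ is Cauchy if for every rational $\varepsilon>0$ there is $q\in\mathbb{Q}$ with $q_\varepsilon\in\mathcal{F}$. A minimal Cauchy filter is a Cauchy filter $\mathcal{F}$ such that any Cauchy filter $\mathcal{G}\subseteq\mathcal{F}$ satisfies $\mathcal{G}=\mathcal{F}$. In this statement $\mathbb{R}$ denotes the set of all minimal Cauchy filters in $\mathbb{Q}$, and its elements are called real numbers. For $A,B\subseteq\mathbb{Q}$ write $A<_\forall B$ if $\alpha<\beta$ for all $\alpha\in A$ and $\beta\in B$. For real numbers $a,b$, $a<b$ means that there exist $A\in a$ and $B\in b$ with $A<_\forall B$; $a\le b$ means $a<b$ or $a=b$. *)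

(* Defs.v *)
From mathcomp Require Import all_boot all_order all_algebra.
From mathcomp Require Import boolp classical_sets filter.

Set Implicit Arguments.
Unset Strict Implicit.
Unset Printing Implicit Defensive.

Import Order.TTheory GRing.Theory Num.Theory.
Local Open Scope classical_set_scope.
Local Open Scope ring_scope.

Definition rat_ball (q e : rat) : set rat := [set x | q - e < x < q + e].

(* [Filter] is closure under supersets and binary intersections together with
   [F setT]; for a superset-closed family the latter says that F is non-empty.
   Since [F set0] is not excluded (unlike in [ProperFilter]), the improper
   filter is a filter, and it is Cauchy. *)
Definition cauchy_filter (F : set_system rat) : Prop :=
  Filter F /\ forall e : rat, 0 < e -> exists q : rat, F (rat_ball q e).

Definition minimal_cauchy_filter (F : set_system rat) : Prop :=
  cauchy_filter F /\ forall G, cauchy_filter G -> G `<=` F -> G = F.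

(* Under propositional extensionality and proof irrelevance (see [boolp]),
   equality in [mcreal] is equality of the underlying families of sets. *)
Record mcreal : Type := MCReal {
  mcfilter : set_system rat;
  mcfilterP : minimal_cauchy_filter mcfilter
}.

Definition lt_forall (A B : set rat) : Prop :=
  forall x y, A x -> B y -> x < y.

Definition mclt (a b : mcreal) : Prop :=
  exists A B, [/\ mcfilter a A, mcfilter b B & lt_forall A B].

Definition mcle (a b : mcreal) : Prop := mclt a b \/ a = b.

Definition mc_upper_bound (S : set mcreal) (u : mcreal) : Prop :=
  forall a, S a -> mcle a u.

Definition mc_least_upper_bound (S : set mcreal) (u : mcreal) : Prop :=
  mc_upper_bound S u /\ forall v, mc_upper_bound S v -> mcle u v.

(* Main.v *)
(** Each minimal Cauchy filter [a] is recovered from its lower cut, the set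
    of rationals lying strictly below some member of [a]: the intervals that
    overlap a cut on both sides generate a minimal Cauchy filter, and the one
    generated by the lower cut of [a] is contained in [a]. In terms of lower
    cuts the order is inclusion, so the union of the lower cuts of the
    elements of [S] generates the least upper bound. *)

Require Import Defs.
From mathcomp Require Import all_boot all_order all_algebra.
From mathcomp Require Import boolp classical_sets filter.
From mathcomp Require Import lra.

Set Implicit Arguments.
Unset Strict Implicit.
Unset Printing Implicit Defensive.

Local Open Scope classical_set_scope.

Import Order.TTheory GRing.Theory Num.Theory.
Local Open Scope ring_scope.

Definition is_cut (L : set rat) : Prop :=
  [/\ L !=set0, ~` L !=set0 & forall p q, q <= p -> L p -> L q].

(** The margin [d] makes every interval reach past both sides of the cut, so it is immaterial
    whether a rational boundary point belongs to [L]. *)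
Definition cut_filter (L : set rat) : set_system rat :=
  [set A | exists p q d, [/\ L p, ~ L q, 0 < d &
    [set x | p - d < x < q + d] `<=` A]].

Lemma cut_lt (L : set rat) (p q : rat) : is_cut L -> L p -> ~ L q -> p < q.
Proof.
move=> [_ _ Ld] Lp nLq; rewrite ltNge; apply/negP => qp.
exact/nLq/(Ld p).
Qed.

(** Archimedean argument: otherwise steps of length [e] from a point of [L] would never leave [L],
    yet they pass any point outside it. *)
Lemma cut_gap (L : set rat) (e : rat) :
  is_cut L -> 0 < e -> exists2 p, L p & ~ L (p + e).
Proof.
move=> cutL e0; have [[p Lp] [q nLq] Ld] := cutL.
apply: contrapT => H.
have step n : L (p + e *+ n).
  elim: n => [|n IH]; first by rewrite mulr0n addr0.
  apply: contrapT => nL; apply: H; exists (p + e *+ n) => //.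
  by rewrite -addrA -mulrSr.
have pq := cut_lt cutL Lp nLq.
have x0 : 0 <= (q - p) / e by rewrite divr_ge0 ?ltW ?subr_gt0.
have := archi_boundP x0; rewrite ltr_pdivrMr // mulr_natl => lt_n.
apply: nLq; apply: (Ld _ _ _ (step (Num.bound ((q - p) / e)))).
lra.
Qed.

Lemma cut_filter_cauchy (L : set rat) :
  is_cut L -> cauchy_filter (cut_filter L).
Proof.
move=> cutL; split.
  have [[p0 Lp0] [q0 nLq0] _] := cutL; split.
  - by exists p0, q0, 1; split.
  - move=> A B [p [q [d [Lp nLq d0 sA]]]] [p' [q' [d' [Lp' nLq' d'0 sB]]]].
    exists (Num.max p p'), (Num.min q q'), (Num.min d d').
    split; [by case: leP | by case: leP | by case: (leP d d') |].
    move=> x /= xI; split; [apply: sA | apply: sB] => /=; move: xI;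
      case: (leP p p') => h1; case: (leP q q') => h2; case: (leP d d') => h3;
      lra.
  - move=> A B AB [p [q [d [Lp nLq d0 sA]]]].
    by exists p, q, d; split => //; apply: subset_trans AB.
move=> e e0; have e20 : 0 < e / 2 by lra.
have [p Lp nLp] := cut_gap cutL e20.
exists p, p, (p + e / 2), (e / 2); split => // x /=; rewrite /rat_ball /=; lra.
Qed.

Lemma cut_filter_minimal (L : set rat) :
  is_cut L -> minimal_cauchy_filter (cut_filter L).
Proof.
move=> cutL; split; first exact: cut_filter_cauchy.
move=> G [GF Gc] GL; rewrite eqEsubset; split => // A [p [q [d [Lp nLq d0 sA]]]].
have d20 : 0 < d / 2 by lra.
have [c Gb] := Gc _ d20; apply: filterS (Gb) => // x xb; apply: sA.
have [r [s [d' [Lr nLs d'0 sb]]]] := GL _ Gb.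
have := cut_lt cutL Lp nLq; have := cut_lt cutL Lr nLs.
have := cut_lt cutL Lp nLs; have := cut_lt cutL Lr nLq => rq ps rs pq.
(* [Num.max p r] is in [L], hence below both [q] and [s]. It is thus a point of the ball lying
   between [p] and [q], and the ball has width [d]. *)
have /sb : [set x | r - d' < x < s + d'] (Num.max p r).
  by rewrite /=; case: (leP p r); lra.
move: xb; rewrite /rat_ball /=; case: (leP p r); lra.
Qed.

Lemma cut_filter_neq0 (L : set rat) : is_cut L -> ~ cut_filter L set0.
Proof.
move=> cutL [p [q [d [Lp nLq d0 s0]]]]; have pq := cut_lt cutL Lp nLq.
by apply: (s0 p) => /=; lra.
Qed.

Definition lower_cut (F : set_system rat) : set rat :=
  [set q | exists2 A, F A & forall x, A x -> q < x].

(** The improper filter contains the proper Cauchy filter generated by the cut at 0, so it is not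
    minimal. *)
Lemma minimal_cauchy_filter_neq0 (F : set_system rat) :
  minimal_cauchy_filter F -> ~ F set0.
Proof.
move=> [[FF Fc] Fm] F0.
have cut0 : is_cut [set x : rat | x < 0].
  split; [by exists (-1) => /=; lra | by exists 1 => /=; lra |].
  by move=> p q /= qp p0; apply: le_lt_trans p0.
apply: (cut_filter_neq0 cut0); rewrite (Fm _ (cut_filter_cauchy cut0)) //.
by move=> A _; apply: filterS F0.
Qed.

Lemma minimal_cauchy_filter_meets (F : set_system rat) (A B : set rat) :
  minimal_cauchy_filter F -> F A -> F B -> exists x, A x /\ B x.
Proof.
move=> Fm FA FB; apply: contrapT => nAB.
have [[FF _] _] := Fm.
apply: (minimal_cauchy_filter_neq0 Fm); apply: filterS (filterI FA FB) => x ABx.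
by apply: nAB; exists x.
Qed.

Lemma lower_cut_is_cut (F : set_system rat) :
  minimal_cauchy_filter F -> is_cut (lower_cut F).
Proof.
move=> Fm; have [[FF Fc] _] := Fm; have [c Fb] := Fc 1 ltr01; split.
- by exists (c - 1), (rat_ball c 1) => // x /andP[].
- exists (c + 1) => -[A FA cA].
  have [x [/cA cx /andP[_]]] := minimal_cauchy_filter_meets Fm FA Fb; lra.
- move=> p q qp [A FA pA]; exists A => // x /pA; exact: le_lt_trans.
Qed.

(** A ball of radius [d / 2] in [F] with a point at or above [q + d] would lie wholly above [q],
    putting [q] in the lower cut. *)
Lemma cauchy_filter_upper (F : set_system rat) (q d : rat) :
  cauchy_filter F -> ~ lower_cut F q -> 0 < d -> F [set x | x < q + d].
Proof.
move=> [FF Fc] nq d0; have d20 : 0 < d / 2 by lra.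
have [c Fb] := Fc _ d20; apply: filterS (Fb) => // x xb; apply: contrapT => xq.
apply: nq; exists (rat_ball c (d / 2)) => // y; move: xb xq.
rewrite /rat_ball /= => xb /negP; rewrite -leNgt; lra.
Qed.

Lemma cut_filter_lower_cut (F : set_system rat) :
  minimal_cauchy_filter F -> cut_filter (lower_cut F) = F.
Proof.
move=> Fm; have [[FF Fc] min] := Fm.
apply: min; first exact/cut_filter_cauchy/lower_cut_is_cut.
move=> A [p [q [d [[B FB pB] nq d0 sA]]]].
have Fq := cauchy_filter_upper (conj FF Fc) nq d0.
apply: filterS (filterI FB Fq) => x [/pB px xq]; apply: sA => /=.
move: xq => /=; lra.
Qed.

Lemma lower_cut_cut_filter (L : set rat) (q : rat) :
  is_cut L -> lower_cut (cut_filter L) q <-> exists2 p, L p & q < p.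
Proof.
move=> cutL; split.
  move=> [A [p [r [d [Lp nLr d0 sA]]]] qA]; exists p => //.
  apply: qA; apply: sA => /=; have := cut_lt cutL Lp nLr; lra.
move=> [p Lp qp]; have [_ [r nLr] _] := cutL.
(* The margin [p - q] places the left endpoint exactly at [q]. *)
exists [set x | p - (p - q) < x < r + (p - q)]; last by move=> x /=; lra.
by exists p, r, (p - q); split => //; lra.
Qed.

Lemma lower_cut_round (F : set_system rat) (q : rat) :
  minimal_cauchy_filter F -> lower_cut F q -> exists2 p, lower_cut F p & q < p.
Proof.
move=> Fm; rewrite -{1}(cut_filter_lower_cut Fm).
by move/(lower_cut_cut_filter q (lower_cut_is_cut Fm)).
Qed.

Lemma mcreal_eq (a b : mcreal) : mcfilter a = mcfilter b -> a = b.
Proof.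
by case: a b => [F Fm] [G Gm] /= FG; subst G; rewrite (Prop_irrelevance Fm Gm).
Qed.

Lemma mcleP (a b : mcreal) :
  mcle a b <-> lower_cut (mcfilter a) `<=` lower_cut (mcfilter b).
Proof.
have am := mcfilterP a; have bm := mcfilterP b; split.
  case=> [[A [B [aA bB AB]]]|-> //] q [A' aA' qA'].
  have [x [Ax A'x]] := minimal_cauchy_filter_meets am aA aA'.
  by exists B => // y By; apply: lt_trans (qA' _ A'x) (AB _ _ Ax By).
move=> ab; have [ba|] := pselect
  (lower_cut (mcfilter b) `<=` lower_cut (mcfilter a)).
  right; apply: mcreal_eq.
  rewrite -(cut_filter_lower_cut am) -(cut_filter_lower_cut bm).
  by congr cut_filter; rewrite eqEsubset.
move=> /existsNP[q /not_implyP[bq naq]]; left.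
have [p [B bB pB] qp] := lower_cut_round bm bq.
have pq0 : 0 < p - q by rewrite subr_gt0.
(* The rational [p] separates: the first set lies below it, [B] above it. *)
exists [set x | x < q + (p - q)], B; split => //.
  exact: cauchy_filter_upper am.1 naq pq0.
by move=> x y /= xp /pB; lra.
Qed.

Theorem mainTheorem5 (S : set mcreal) :
  S !=set0 ->
  (exists b : mcreal, mc_upper_bound S b) ->
  exists u : mcreal, mc_least_upper_bound S u.
Proof.
move=> [a0 Sa0] [b Sb].
pose L : set rat := [set q | exists2 a, S a & lower_cut (mcfilter a) q].
have cutL : is_cut L.
  have [[p ap] _ _] := lower_cut_is_cut (mcfilterP a0).
  have [_ [q nbq] _] := lower_cut_is_cut (mcfilterP b).
  split; first by exists p, a0.
    (* A point outside the lower cut of the bound [b] is outside every lower cut in the union. *)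
    by exists q => -[a Sa aq]; apply: nbq; move/mcleP: (Sb a Sa); apply.
  move=> r s sr [a Sa ar]; exists a => //.
  by have [_ _ ad] := lower_cut_is_cut (mcfilterP a); apply: ad ar.
exists (MCReal (cut_filter_minimal cutL)); split.
  move=> a Sa; apply/mcleP => q aq /=; apply/lower_cut_cut_filter => //.
  (* The lower cut of [cut_filter L] holds only the points strictly below some point of [L], so [q]
     needs a larger [p] in the lower cut of [a]. *)
  have [p ap qp] := lower_cut_round (mcfilterP a) aq.
  by exists p => //; exists a.
move=> v Sv; apply/mcleP => q /= /(lower_cut_cut_filter q cutL)[p [a Sa ap] qp].
have [_ _ vd] := lower_cut_is_cut (mcfilterP v).
by apply: (vd p); [exact: ltW | move/mcleP: (Sv a Sa); apply].
Qed.
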